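(* Let $\alpha,\beta>-1/2$ and consider the product Gegenbauer weight, with $\mathbb{Q}_n,\mathbb{S}_n,\mathbf{C}_n,\mathbf{D}_n$ and $\mathbf{B}_n$ as in the context. Let $\mathbf{H}_n^\nabla:=\langle\mathbb{S}_n,\mathbb{S}_n^{\mathsf T}\rangle_\nabla$. Then $\mathbf{H}_n^\nabla$ satisfies the recursive relation $$\mathbf{H}_n^\nabla=\mathbf{D}_n-\mathbf{C}_{n-2}(\mathbf{H}_{n-2}^\nabla)^{-1}\mathbf{C}_{n-2}^{\mathsf T}\qquad(n\ge3),$$ where the iteration is initiated by $\mathbf{H}_1^\nabla=\mathbf{I}$, the identity matrix, and $\mathbf{H}_2^\nabla=\mathbf{D}_2$. Furthermore, for $n=1,2,\ldots$, the matrix $\mathbf{B}_n$ in the relation $\mathbb{Q}_{n+2}\doteq\mathbb{S}_{n+2}+\mathbf{B}_n\mathbb{S}_n$ is determined by $$\mathbf{B}_n=\mathbf{C}_n(\mathbf{H}_n^\nabla)^{-1}.$$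
   Context: For $\alpha>-1/2$ let $u_\alpha(x)=(1-x^2)^{\alpha-1/2}$ on $[-1,1]$, and let $p_n(u_\alpha;\cdot)$ be its monic orthogonal polynomial of degree $n$. Let $b_{n-1}(\alpha)=-\frac{n-1}{4(n+\alpha-1)(n+\alpha-2)}$ for $n\ge2$, and let $q_0(u_\alpha;x)=1$, $q_1(u_\alpha;x)=p_1(u_\alpha;x)=x$, $q_n(u_\alpha;x)=p_n(u_\alpha;x)+n\,b_{n-1}(\alpha)p_{n-2}(u_\alpha;x)$ for $n\ge2$; these satisfy $q_n'(u_\alpha;x)=n\,p_{n-1}(u_\alpha;x)$ for $n\ge1$. For $0\le k\le n$ put $Q_k^n(x,y)=q_{n-k}(u_\alpha;x)q_k(u_\beta;y)$ and $\mathbb{Q}_n=(Q_0^n,\dots,Q_n^n)^{\mathsf T}$. Let $U_{\alpha,\beta}(x,y)=u_\alpha(x)u_\beta(y)$ on $[-1,1]^2$, $c_{\alpha,\beta}=1/\int_{[-1,1]^2}U_{\alpha,\beta}$, and $$\langle f,g\rangle_\nabla=c_{\alpha,\beta}\int_{[-1,1]^2}\nabla f\cdot\nabla g\,U_{\alpha,\beta}\,dx\,dy.$$ For column vectors of polynomials $\mathbb{F},\mathbb{G}$, $\langle\mathbb{F},\mathbb{G}^{\mathsf T}\rangle_\nabla$ is the matrix of entries $\langle F_i,G_j\rangle_\nabla$. Let $\Pi_n^2$ be the space of real polynomials in $x,y$ of total degree at most $n$. For $n\ge1$, $0\le k\le n$, $S_k^n$ is a monic orthogonal polynomial for $\langle\cdot,\cdot\rangle_\nabla$: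 $S_k^n-x^{n-k}y^k\in\Pi_{n-1}^2$ and $\langle S_k^n,P\rangle_\nabla=0$ for all $P\in\Pi_{n-1}^2$ (determined up to an additive constant); $\mathbb{S}_n=(S_0^n,\dots,S_n^n)^{\mathsf T}$. Put $\mathbf{C}_n=\langle\mathbb{Q}_{n+2},\mathbb{Q}_n^{\mathsf T}\rangle_\nabla$ and $\mathbf{D}_n=\langle\mathbb{Q}_n,\mathbb{Q}_n^{\mathsf T}\rangle_\nabla$. Write $f\doteq g$ if $f-g$ is constant (componentwise for vectors). For the product Gegenbauer weight there are real matrices $\mathbf{B}_{n-2}$ with $\mathbb{Q}_n\doteq\mathbb{S}_n+\mathbf{B}_{n-2}\mathbb{S}_{n-2}$ for $n\ge3$. *)

(* Defs.v *)
From HB Require Import structures.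
From mathcomp Require Import all_boot all_order all_algebra.
From mathcomp Require Import all_classical all_reals all_analysis.

Set Implicit Arguments.
Unset Strict Implicit.
Unset Printing Implicit Defensive.

Import Order.TTheory GRing.Theory Num.Theory.

Local Open Scope classical_set_scope.
Local Open Scope ring_scope.

(* A bivariate polynomial is an element of {poly {poly R}} with the polyXY
   conventions: the outer indeterminate 'X is x and 'Y = 'X%:P is y, so that
   P`_i`_j is the coefficient of x^i y^j and P.[x, y] is the value at (x, y). *)

Section Gegenbauer.
Variable R : realType.
Implicit Types (a x y : R) (m n k : nat).

(* For a < 1/2 the weight is singular at -1 and 1; there powR returns a junk
   value, on a Lebesgue-null set. *)
Definition gegenbauer_weight a x : R := (1 - x ^+ 2) `^ (a - 2^-1).

Definition monic_orthogonal_poly a n (p : {poly R}) : Prop :=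
  [/\ size p = n.+1, p \is monic &
      forall g : {poly R}, (size g <= n)%N ->
        \int[lebesgue_measure]_(x in `[(-1 : R), 1])
          (p.[x] * g.[x] * gegenbauer_weight a x) = 0].

(* b_m(a) for m >= 1.  The only vanishing denominator for a > -1/2 is at
   m = 1, a = 0, where this is 0 and hence q_2 = p_2 below; an additive
   constant in q_2 does not affect q_2' = 2 p_1. *)
Definition gegenbauer_b a m : R :=
  - (m%:R / (4 * (m%:R + a) * (m%:R + a - 1))).

Definition gegenbauer_q a (p : nat -> {poly R}) n : {poly R} :=
  match n with
  | 0 => 1
  | 1 => p 1%N
  | m.+2 => p m.+2 + (m.+2%:R * gegenbauer_b a m.+1) *: p m
  end.

End Gegenbauer.

Section Sobolev.
Variables (R : realType) (a b : R).
Implicit Types (f g P : {poly {poly R}}) (n k : nat).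

Definition tdegree_le n P : Prop :=
  forall i j, P`_i`_j != 0 -> (i + j <= n)%N.

Definition dx P : {poly {poly R}} := P^`().
Definition dy P : {poly {poly R}} := map_poly (@deriv R) P.

Definition product_weight (z : R * R) : R :=
  gegenbauer_weight a z.1 * gegenbauer_weight b z.2.

Definition square_integral (F : R * R -> R) : R :=
  \int[(lebesgue_measure \x lebesgue_measure)%E]_(z in
    `[(-1 : R), 1] `*` `[(-1 : R), 1]) F z.

Definition grad_inner f g : R :=
  (square_integral product_weight)^-1 *
  square_integral (fun z =>
    ((dx f).[z.1, z.2] * (dx g).[z.1, z.2] +
     (dy f).[z.1, z.2] * (dy g).[z.1, z.2]) * product_weight z).

Definition grad_gram m n (F : 'cV[{poly {poly R}}]_m)
    (G : 'cV[{poly {poly R}}]_n) : 'M[R]_(m, n) :=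
  \matrix_(i, j) grad_inner (F i 0) (G j 0).

Definition monic_grad_orthogonal n k P : Prop :=
  tdegree_le n.-1 (P - 'X^(n - k) * 'Y ^+ k) /\
  (forall g, tdegree_le n.-1 g -> grad_inner P g = 0).

Definition product_q (p r : nat -> {poly R}) n : 'cV[{poly {poly R}}]_n.+1 :=
  \col_(k < n.+1)
    ((gegenbauer_q a p (n - k))^:P * (gegenbauer_q b r k)%:P).

Definition real_mulmx m n (B : 'M[R]_(m, n))
    (F : 'cV[{poly {poly R}}]_n) : 'cV[{poly {poly R}}]_m :=
  map_mx (fun c : R => c%:P%:P) B *m F.

Definition eq_upto_const n (F G : 'cV[{poly {poly R}}]_n) : Prop :=
  forall i, exists c : R, F i 0 - G i 0 = c%:P%:P.

End Sobolev.

(* Main.v *)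
(* The Gegenbauer weight is integrable and satisfies the Pearson equation
   ((1 - x^2) w)' = - (2a + 1) x w.  Together with positivity of f |-> \int f^2 w
   this forces the second order differential equation on every monic orthogonal
   family, hence a two-term recurrence on its coefficients, hence
   q_n' = n p_(n-1).  By Fubini the gradient inner product of two products
   q_i(x) q_j(y) factors, so Q_n and Q_m are orthogonal unless n - m is 0, 2 or
   -2.  By induction S_n is then orthogonal to Q_m whenever m > n and m - n is
   odd.  As the Q_m with m <= n span the polynomials of degree <= n and the form
   is definite modulo constants, Q_(n+2) - S_(n+2) - B S_n is constant exactly
   when B = C_n H_n^-1; pairing this relation with Q_(n+2) gives the recursion
   on H_n. *)

From HB Require Import structures.
Require Import Defs.
From mathcomp Require Import all_boot all_order all_algebra.
From mathcomp Require Import all_classical all_reals all_analysis.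
From mathcomp Require Import measurable_realfun.
From mathcomp Require Import zify ring lra.

Set Implicit Arguments.
Unset Strict Implicit.
Unset Printing Implicit Defensive.

Import Order.TTheory GRing.Theory Num.Theory.
Import numFieldNormedType.Exports.

Local Open Scope classical_set_scope.
Local Open Scope ring_scope.

(** * The Gegenbauer weight: integrability, Pearson identity, positivity *)

Section Weight.
Variables (R : realType) (a : R).

Local Notation w := (gegenbauer_weight a).
Local Notation mu := (@lebesgue_measure R).
Local Notation s := (a + 2^-1).

Lemma sqr1B_gt0 (c x : R) : c < 1 -> x \in `[- c, c] -> 0 < 1 - x ^+ 2.
Proof. by rewrite in_itv/= => c1 /andP[? ?]; nra. Qed.

Lemma weight_ge0 x : 0 <= w x.
Proof. exact: powR_ge0. Qed.

Lemma weight_gt0 x : -1 < x < 1 -> 0 < w x.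
Proof. by move=> /andP[? ?]; apply: powR_gt0; nra. Qed.

Lemma measurable_weight : measurable_fun [set: R] w.
Proof.
apply: (@measurableT_comp _ _ _ _ _ _ (@powR R ^~ (a - 2^-1))) => //.
by apply: measurable_funB => //; exact: measurable_funX.
Qed.

Lemma measurable_horner_weight (f : {poly R}) D :
  measurable_fun D (fun x : R => (f.[x] * w x)%:E).
Proof.
apply/measurable_EFinP; apply: measurable_funM; first exact: measurable_poly.
exact: measurable_funTS measurable_weight.
Qed.

Lemma is_derive_horner (f : {poly R}) (x : R) : is_derive x (1 : R) (horner f) f^`().[x].
Proof. by rewrite derivE derive1E; apply/derivableP/derivable_horner. Qed.

Lemma weight_powR x : 0 < 1 - x ^+ 2 -> (1 - x ^+ 2) * w x = (1 - x ^+ 2) `^ s.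
Proof.
move=> x1; rewrite (_ : s = 1 + (a - 2^-1)); last by field.
by rewrite powRD ?powRr1 ?(ltW x1)// (gt_eqF x1) implybT.
Qed.

(* [pearson f * w] is the derivative of [f * (1 - x^2) * w]. *)
Definition pearson (f : {poly R}) : {poly R} :=
  (1 - 'X^2) * f^`() - (2 * a + 1) *: ('X * f).

Lemma is_derive_powR_1Bsqr (e x : R) : 0 < 1 - x ^+ 2 ->
  is_derive x (1 : R) (fun t : R => (1 - t ^+ 2) `^ e)
    (e * (1 - x ^+ 2) `^ (e - 1) * (- (x *+ 2))).
Proof.
move=> x1; pose q : {poly R} := 1 - 'X^2.
have qE t : q.[t] = 1 - t ^+ 2 by rewrite /q !hornerE.
have -> : (fun t : R => (1 - t ^+ 2) `^ e) = (@powR R ^~ e) \o (horner q).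
  by apply/funext => t; rewrite /= qE.
apply: (@is_derive1_comp _ _ _ _ _ _ _ _); last first.
  apply: (is_derive_eq (is_derive_horner q x)).
  by rewrite /q derivB derivC derivXn !hornerE.
by rewrite qE; apply: is_derive1_powR.
Qed.

Lemma horner_pearson f x :
  (pearson f).[x] = (1 - x ^+ 2) * f^`().[x] - (2 * a + 1) * (x * f.[x]).
Proof. by rewrite /pearson !(hornerD, hornerN, hornerZ, hornerM, hornerX, hornerXn, hornerC). Qed.

(** Since [(1 - t^2) w = (1 - t^2)^s] with [2 s = 2 a + 1], the derivative of this factor is
    [- (2 a + 1) t w]; the product rule does the rest. *)
Lemma is_derive_pearson (f : {poly R}) (x : R) : 0 < 1 - x ^+ 2 ->
  is_derive x (1 : R) (fun t => f.[t] * (1 - t ^+ 2) `^ s) ((pearson f).[x] * w x).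
Proof.
move=> x1.
have dv := is_derive_powR_1Bsqr s x1.
have df := is_derive_horner f x.
apply: (is_derive_eq (is_deriveM df dv)).
have -> : s - 1 = a - 2^-1 by field.
rewrite -/(w x) -weight_powR//.
rewrite -[LHS]/(f.[x] * (s * w x * - (x *+ 2)) + (1 - x ^+ 2) * w x * f^`().[x]).
by rewrite horner_pearson; field.
Qed.

Lemma continuous_horner_weight (f : {poly R}) c : c < 1 ->
  {within `[- c, c], continuous (fun x => f.[x] * w x)}.
Proof.
move=> c1; apply: derivable_within_continuous => x /(sqr1B_gt0 c1) x1.
have [dw _] := is_derive_powR_1Bsqr (a - 2^-1) x1.
by apply: derivableM; [exact: derivable_horner|exact: dw].
Qed.

(** The weight may be singular at -1 and 1, so the fundamental theorem of calculus is applied on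
    compact subintervals of []-1, 1[]; the boundary terms stay explicit for the later limit. *)
Lemma integral_pearson_sub (f : {poly R}) c : 0 < c -> c < 1 ->
  (\int[mu]_(x in `[(- c)%R, c]) ((pearson f).[x] * w x)%:E =
   (f.[c] * (1 - c ^+ 2) `^ s - f.[- c] * (1 - c ^+ 2) `^ s)%:E)%E.
Proof.
move=> c0 c1.
have cc : - c < c by lra.
have dF x : x \in `[- c, c] ->
   derivable (fun t => f.[t] * (1 - t ^+ 2) `^ s) x 1.
  by move=> /(sqr1B_gt0 c1) x1; case: (is_derive_pearson f x1).
rewrite (@continuous_FTC2 _ _ (fun t => f.[t] * (1 - t ^+ 2) `^ s))//.
- by rewrite -EFinB sqrrN.
- exact: continuous_horner_weight.
- have /derivable_within_continuous/(continuous_within_itvP _ cc)[_ ? ?] := dF.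
  split=> // x xc; apply: dF; exact: subset_itv_oo_cc xc.
- move=> x /subset_itv_oo_cc /(sqr1B_gt0 c1) x1.
  by rewrite derive1E; case: (is_derive_pearson f x1).
Qed.

Hypothesis a_gt : - 2^-1 < a.

(** Endpoints of an exhaustion of []-1, 1[] by compact intervals. The shift by 2 makes already
    [c_ 0 = 1/2] positive. *)
Let c_ (n : nat) : R := 1 - n.+2%:R^-1.

Let c_gt0 n : 0 < c_ n.
Proof. by rewrite subr_gt0 invf_lt1// ltr1n. Qed.

Let c_lt1 n : c_ n < 1.
Proof. by rewrite gtrBl invr_gt0. Qed.

Let c_near (x : R) : -1 < x < 1 -> \forall n \near \oo, x \in `[- c_ n, c_ n].
Proof.
move=> x1.
have e0 : 0 < 1 - `|x| by rewrite subr_gt0 ltr_norml.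
near=> n; rewrite in_itv/= -ler_norml /c_ lerBrDr -lerBrDl.
apply: le_trans (ltW _ : n.+1%:R^-1 <= _).
  by rewrite lef_pV2 ?posrE// ler_nat.
by near: n; exact: (near_infty_natSinv_lt (PosNum e0)).
Unshelve. all: by end_near. Qed.

Let c_subset m n : (m <= n)%N -> `[- c_ m, c_ m] `<=` `[- c_ n, c_ n].
Proof.
move=> mn; have cc : c_ m <= c_ n by rewrite lerD2l lerN2 lef_pV2 ?posrE// ler_nat.
by apply: subset_itvScc; rewrite bnd_simp ?lerN2.
Qed.

Let bigcup_c_ : \bigcup_n `[- c_ n, c_ n]%classic = `]-1, 1[%classic.
Proof.
apply/seteqP; split=> [x [n _]|x /= x1].
  rewrite /= !in_itv/= => /andP[? ?]; have := c_lt1 n; lra.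
have [n _ /(_ n (leqnn n)) ?] : \forall n \near \oo, x \in `[- c_ n, c_ n].
  by apply: c_near; move: x1; rewrite in_itv.
by exists n.
Qed.

Lemma integral_weight_sub c : 0 < c -> c < 1 ->
  (\int[mu]_(x in `[(- c)%R, c]) (w x)%:E <= (2 + s^-1)%:E)%E.
Proof.
move=> c0 c1; have cc : - c < c by lra.
have s0 : 0 < s by rewrite -ltrBlDr sub0r.
have intf f : mu.-integrable `[-c, c] (EFin \o (fun x => f.[x] * w x)).
  by apply: continuous_compact_integrable; [exact: segment_compact|exact: continuous_horner_weight].
(* Integrating [pearson 'X * w = (1 - x^2) w - 2 s x^2 w] over [-c, c] leaves a
   nonnegative boundary term, so [2 s x^2 w] integrates to at most what
   [(1 - x^2) w <= 1] does. *)
pose v x := (1 - 'X^2 : {poly R}).[x] * w x.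
have v2 : (\int[mu]_(x in `[(- c)%R, c]) (v x)%:E <= 2%:E)%E.
  apply: (@le_trans _ _ (\int[mu]_(x in `[(- c)%R, c]) 1%:E)%E).
    apply: ge0_le_integral => //.
    - by move=> x /(sqr1B_gt0 c1) x1; rewrite lee_fin /v mulr_ge0 ?weight_ge0// !hornerE ltW.
    - exact: (measurable_int _ (intf _)).
    - move=> x /(sqr1B_gt0 c1) x1; rewrite lee_fin /v !hornerE.
      rewrite weight_powR// -[X in _ <= X](powRr0 (1 - x ^+ 2)).
      apply: ger_powR; last exact: ltW.
      by rewrite x1/= lerBlDr lerDl sqr_ge0.
  rewrite integral_cst//= mul1e lebesgue_measure_itv/= lte_fin cc -EFinB lee_fin; lra.
(* Here [f] is [2 s x^2], and the second clause is the splitting [w = (1 - x^2) w + x^2 w]. *)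
have [f f2 fv]: exists2 f, (\int[mu]_(x in `[(- c)%R, c]) (f.[x] * w x)%:E <= 2%:E)%E
  & forall x, w x = v x + s^-1 * (2^-1 * (f.[x] * w x)).
  exists ((2 * s) *: 'X^2).
    have : (0 <= \int[mu]_(x in `[(- c)%R, c]) ((pearson 'X).[x] * w x)%:E)%E.
      rewrite integral_pearson_sub// lee_fin !hornerE -mulrBl.
      by rewrite mulr_ge0 ?powR_ge0//; lra.
    under eq_integral => x _.
      have -> : (pearson 'X).[x] * w x = v x - ((2 * s) *: 'X^2).[x] * w x.
        by rewrite horner_pearson derivX /v !hornerE /=; field.
      over.
    rewrite (_ : (fun x => (v x - _)%:E) =
      (fun x => (v x)%:E - (((2 * s) *: 'X^2).[x] * w x)%:E)%E)//.
    rewrite integralB//=; [|exact: intf..].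
    rewrite sube_ge0; last first.
      by rewrite (integrable_fin_num _ (intf _))// orbT.
    by move=> /le_trans; exact.
  move=> x; rewrite /v !(hornerD, hornerN, hornerZ, hornerM, hornerX, hornerXn, hornerC).
  field.
  by rewrite (_ : a * 2 + 1 = 2 * s) ?mulf_neq0// ?gt_eqF//; field.
under eq_integral => x _ do rewrite fv EFinD.
rewrite integralD//=; last first.
  rewrite (_ : (fun _ => _) = (fun x => (s^-1 * 2^-1)%:E * (f.[x] * w x)%:E))%E.
    by apply: integrableZl => //; exact: intf.
  by apply/funext => x; rewrite -EFinM mulrA.
- exact: intf.
rewrite EFinD; apply: leeD => //.
rewrite (_ : (fun _ => _) = (fun x => (s^-1 * 2^-1)%:E * (f.[x] * w x)%:E))%E; last first.
  by apply/funext => x; rewrite -EFinM mulrA.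
rewrite integralZl//; last exact: intf.
rewrite EFinM -muleA -[leRHS]mule1 lee_pmul2l ?lte_fin ?invr_gt0//.
rewrite (_ : 1%:E = (2^-1)%:E * 2%:E)%E; last by rewrite -EFinM mulVf.
by rewrite lee_pmul2l ?lte_fin ?invr_gt0.
Qed.

(** Monotone convergence along the intervals [[- c_ n, c_ n]]: the bound of [integral_weight_sub]
    does not depend on the interval. *)
Lemma integral_weight_lty : (\int[mu]_(x in `]((-1)%R : R), (1%R : R)[) (w x)%:E < +oo)%E.
Proof.
rewrite -bigcup_c_; apply: (@le_lt_trans _ _ (2 + s^-1)%:E); last exact: ltry.
have mw D : measurable_fun D (fun x : R => (w x)%:E).
  by apply/measurable_EFinP; apply: measurable_funTS measurable_weight.
have cv := @ge0_nondecreasing_set_cvg_integral _ (measurableTypeR R) R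
   (fun n => `[- c_ n, c_ n]%classic) (EFin \o w) lebesgue_measure.
have {cv} cv := cv _ (fun=> measurable_itv _) (fun=> mw _)
   (fun _ _ _ => weight_ge0 _).
rewrite -(cvg_lim _ (cv _))//; last first.
  by move=> m n mn; rewrite subsetEset; exact: c_subset.
apply: lime_le.
  apply: ereal_nondecreasing_is_cvgn => m n mn.
  apply: ge0_subset_integral => //= [|x _|].
  - exact: mw.
  - by rewrite lee_fin weight_ge0.
  - exact: c_subset.
by near=> n; exact: integral_weight_sub.
Unshelve. all: by end_near. Qed.

Lemma integrable_weight : mu.-integrable `[-1, 1] (EFin \o w).
Proof.
have mw D : measurable_fun D (fun x : R => (w x)%:E).
  by apply/measurable_EFinP; apply: measurable_funTS measurable_weight.
apply/integrableP; split; first exact: mw.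
under eq_integral => x _ do rewrite /= ger0_norm ?weight_ge0//.
rewrite -integral_itv_bndo_bndc// -integral_itv_obnd_cbnd//.
exact: integral_weight_lty.
Qed.

Lemma integrable_horner_weight (f : {poly R}) :
  mu.-integrable `[-1, 1] (fun x => (f.[x] * w x)%:E).
Proof.
have [M Mge0 fM] : exists2 M, 0 <= M & forall x, x \in `[(-1 : R), 1] -> `|f.[x]| <= M.
  exists (\sum_(i < size f) `|f`_i|); first exact: sumr_ge0.
  move=> x; rewrite in_itv/= -ler_norml => x1.
  rewrite horner_coef (le_trans (ler_norm_sum _ _ _))//.
  apply: ler_sum => i _; rewrite normrM ler_piMr// normrX.
  exact: exprn_ile1.
apply: (@le_integrable _ _ _ mu _ _ _ (fun x => (M * w x)%:E)) => //.
- exact: measurable_horner_weight.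
- move=> x x1; rewrite /= lee_fin !normrM (ger0_norm Mge0) ler_wpM2r//.
  exact: fM.
- rewrite (_ : (fun _ => _) = (fun x => M%:E * (w x)%:E)%E)//.
  exact: integrableZl integrable_weight.
Qed.

Definition gint (f : {poly R}) : R :=
  \int[mu]_(x in `[(-1 : R), 1]) (f.[x] * w x).

Lemma gintE f : (gint f)%:E = (\int[mu]_(x in `[(-1)%R, 1%R]) (f.[x] * w x)%:E)%E.
Proof.
by rewrite fineK//; apply: integrable_fin_num => //; exact: integrable_horner_weight.
Qed.

Lemma gint_is_linear : linear_for *%R gint.
Proof.
move=> k f g; rewrite /gint.
under eq_Rintegral => x _ do rewrite hornerD hornerZ mulrDl -mulrA.
rewrite RintegralD ?RintegralZl//; try exact: integrable_horner_weight.
rewrite (_ : _ \o _ = (fun x => k%:E * (f.[x] * w x)%:E)%E)//.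
exact/integrableZl/integrable_horner_weight.
Qed.

(** Bundling the integral as a linear form lets the algebra below run over abstract forms.
    Additivity rests on integrability, hence on [a_gt]. *)
Definition gint_linear : {scalar {poly R}} :=
  HB.pack gint (GRing.isLinear.Build R {poly R} R *%R gint gint_is_linear).

Lemma gint_open f : (gint f)%:E = (\int[mu]_(x in `](-1)%R, 1%R[) (f.[x] * w x)%:E)%E.
Proof.
have mf := measurable_horner_weight f.
by rewrite gintE -integral_itv_bndo_bndc// -integral_itv_obnd_cbnd.
Qed.

(** Dominated convergence: the truncations of the integrand to [[- c_ n, c_ n]] are dominated by its
    absolute value, and their integrals are boundary terms that tend to 0 because [s > 0]. *)
Lemma gint_pearson f : gint (pearson f) = 0.
Proof.
apply: EFin_inj; rewrite gint_open.
have mf := measurable_horner_weight (pearson f).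
set g := fun x => ((pearson f).[x] * w x)%:E.
have ig : mu.-integrable `]-1, 1[ g.
  by apply: integrableS (integrable_horner_weight _) => //; exact: subset_itv_oo_cc.
have := @dominated_cvg _ _ R mu `]-1, 1[%classic (measurable_itv _)
  (fun n => g \_ `[- c_ n, c_ n]%classic) g (fun x => `|g x|%E).
have cI n : `]-1, 1[%classic `&` `[- c_ n, c_ n]%classic = `[- c_ n, c_ n]%classic.
  apply/setIidr => x /=; rewrite !in_itv/= => /andP[? ?]; have := c_lt1 n; lra.
under eq_cvg => n do rewrite -integral_mkcondr cI integral_pearson_sub//.
move=> cv; apply/esym; apply: cvg_unique (cv _ _ _ _ _) => {cv}.
- exact: ereal_hausdorff.
- apply: cvg_EFin; first exact: nearW.
  have c_cvg : c_ n @[n --> \oo] --> (1 : R).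
    rewrite -[X in _ --> X]subr0; apply: cvgB; first exact: cvg_cst.
    by have := @cvg_harmonic R; rewrite -cvg_shiftS.
  have v_cvg : (1 - c_ n ^+ 2) `^ s @[n --> \oo] --> (0 : R).
    have s0 : 0 < s by rewrite -ltrBlDr sub0r.
    have /cvg_at_rightP := powR_cvg0 s0; apply.
    split=> [n|]; first by have := c_lt1 n; have := c_gt0 n; nra.
    rewrite -[X in _ --> X](subrr 1); apply: cvgB; first exact: cvg_cst.
    by rewrite -[X in _ --> X](mulr1 1); apply: cvgM.
  have fc (u : R^nat) l : u n @[n --> \oo] --> l -> f.[u n] @[n --> \oo] --> f.[l].
    by move=> ul; apply: (cvg_comp _ _ ul); exact: continuous_horner.
  rewrite -(subrr 0) -[X in X - _](mulr0 f.[1]) -[X in _ - X](mulr0 f.[-1]).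
  by apply: cvgB; apply: cvgM => //; apply: fc => //; exact: cvgN.
- by move=> n; apply/(measurable_restrict _ (measurable_itv _) (measurable_itv _)); exact: mf.
- move=> x; rewrite /= in_itv/= => /c_near x1.
  apply: cvg_near_cst; near=> n.
  rewrite patchE ifT//; apply/mem_set.
  by near: n.
- by [].
- exact: integrable_abse.
- move=> n x x1; rewrite patchE; case: ifPn => // _.
  by rewrite abse0.
Unshelve. all: by end_near. Qed.

(** If the integral vanished, [f^2 w] would be zero almost everywhere. As [w > 0] inside, []-1, 1[]
    would be covered by a null set and the finitely many roots of [f], although its measure is 2. *)
Lemma gint_sqr_gt0 f : f != 0 -> 0 < gint (f ^+ 2).
Proof.
move=> f0; rewrite lt_neqAle eq_sym; apply/andP; split; last first.
  by apply: Rintegral_ge0 => x _; rewrite horner_exp mulr_ge0 ?sqr_ge0 ?weight_ge0.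
apply/eqP => L0.
have mf := measurable_horner_weight (f ^+ 2).
have := gint_open (f ^+ 2); rewrite L0 => /esym.
under eq_integral => x _.
  rewrite -[X in X%:E]ger0_norm; last by rewrite horner_exp mulr_ge0 ?sqr_ge0 ?weight_ge0.
  rewrite -abse_EFin; over.
move=> I0; have [N [mN N0 subN]] := iffLR (@ae_eq_integral_abs _ (measurableTypeR R) R
  lebesgue_measure _ (measurable_itv _) _ (mf _)) I0.
have finr : finite_set [set x | root f x].
  apply: contrapT => /(@infinite_set_fset _ _ (size f))[B Bf].
  apply/negP; rewrite -ltnNge; apply: max_poly_roots => //.
    by apply/allP => x xB; exact: Bf.
  exact: finmap.fset_uniq.
have mr : measurable [set x | root f x].
  exact: countable_measurable (finite_set_countable finr).
have : (mu `](-1)%R, 1%R[ <= mu (N `|` [set x | root f x]))%E.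
  apply: le_measure; rewrite ?inE//.
    exact: measurableU.
  move=> x x1; case: (boolP (root f x)) => rx; [by right|left].
  apply: subN => /= /(_ x1) [] /eqP; apply/negP.
  by rewrite mulf_neq0 ?horner_exp ?expf_neq0// gt_eqF// weight_gt0.
apply/negP; rewrite -ltNge.
apply: (@le_lt_trans _ _ (mu N + mu [set x | root f x])%E).
  exact: measureU2.
rewrite N0 add0e countable_lebesgue_measure0; last exact: finite_set_countable.
by rewrite lebesgue_measure_itv/= lte_fin (lt_trans (ltrN10 _))// -EFinB lte_fin opprK addr_gt0.
Qed.

End Weight.

(** * Bivariate polynomials: products f(x) g(y) and total degree *)

Section Bivariate.
Variable R : realType.
Implicit Types (f g : {poly R}) (P Q : {poly {poly R}}).

Lemma coef_poly2 f g i j : (f^:P * g%:P)`_i`_j = f`_i * g`_j.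
Proof. by rewrite coefMC coef_map mul_polyC coefZ. Qed.

Lemma monomialE m k : 'X^m * 'Y ^+ k = ('X^m)^:P * ('X^k)%:P :> {poly {poly R}}.
Proof. by rewrite map_polyXn rmorphXn. Qed.

(** Reduces additive identities on bivariate polynomials to products f(x) g(y). *)
Lemma poly2_sum P : P = \sum_(i < size P) ('X^i)^:P * (P`_i)%:P.
Proof.
rewrite -[LHS]coefK poly_def; apply: eq_bigr => i _.
by rewrite map_polyXn mulrC mul_polyC.
Qed.

Lemma dx_poly2 f g : dx (f^:P * g%:P) = f^`()^:P * g%:P.
Proof. by rewrite /dx derivM derivC mulr0 addr0 deriv_map. Qed.

Lemma dy_poly2 f g : dy (f^:P * g%:P) = f^:P * g^`()%:P.
Proof.
apply/polyP => i; rewrite /dy coef_map /= !coefMC !coef_map /=.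
by rewrite !mul_polyC derivZ.
Qed.

Lemma tdegree_leW m n P : (m <= n)%N -> tdegree_le m P -> tdegree_le n P.
Proof. by move=> mn hP i j /hP/leq_trans; apply. Qed.

Lemma tdegree_leD n P Q : tdegree_le n P -> tdegree_le n Q -> tdegree_le n (P + Q).
Proof.
move=> hP hQ i j; apply: contraNT => nij.
have Z (T : {poly {poly R}}) : tdegree_le n T -> T`_i`_j = 0.
  by move=> hT; apply/eqP; apply: contraNT nij => /hT.
by rewrite !coefD !Z// addr0.
Qed.

Lemma tdegree_leZ n (c : R) P : tdegree_le n P -> tdegree_le n (c%:P%:P * P).
Proof.
move=> hP i j; rewrite !coefCM mulf_eq0 negb_or => /andP[_]; exact: hP.
Qed.

Lemma tdegree_leN n P : tdegree_le n P -> tdegree_le n (- P).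
Proof. by move=> hP i j; rewrite !coefN oppr_eq0; exact: hP. Qed.

Lemma tdegree_le_sum n (I : finType) (F : I -> {poly {poly R}}) :
  (forall i, tdegree_le n (F i)) -> tdegree_le n (\sum_i F i).
Proof.
move=> hF; elim/big_ind: _ => // [i j|P Q]; last exact: tdegree_leD.
by rewrite !coef0 eqxx.
Qed.

Lemma tdegree_le_poly2 m k f g :
  (size f <= m.+1)%N -> (size g <= k.+1)%N -> tdegree_le (m + k) (f^:P * g%:P).
Proof.
move=> sf sg i j; rewrite coef_poly2 mulf_eq0 negb_or => /andP[fi gj].
have H (h : {poly R}) l : h`_l != 0 -> (l < size h)%N.
  by move=> hl; rewrite ltnNge; apply: contra hl => lh; rewrite nth_default.
by apply: leq_add; rewrite -ltnS; [exact: leq_trans (H _ _ fi) sf|exact: leq_trans (H _ _ gj) sg].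
Qed.

Lemma coef_monomial m k i j :
  ('X^m * 'Y ^+ k : {poly {poly R}})`_i`_j = ((i == m) && (j == k))%:R.
Proof. by rewrite monomialE coef_poly2 !coefXn -natrM mulnb. Qed.

Lemma tdegree_le_monic n k P : (k <= n)%N ->
  tdegree_le n.-1 (P - 'X^(n - k) * 'Y ^+ k) -> tdegree_le n P.
Proof.
move=> kn hP; rewrite -(subrK ('X^(n - k) * 'Y ^+ k) P); apply: tdegree_leD.
  exact: tdegree_leW (leq_pred n) hP.
rewrite monomialE -[n in tdegree_le n](subnK kn).
by apply: tdegree_le_poly2; rewrite size_polyXn.
Qed.

(** The condition [0 < n] matters: for [n = 0] the predecessor is again 0, and the degree bound
    would leave the constant coefficient free. *)
Lemma coef_monic n k i j P : (0 < n)%N -> (k <= n)%N -> (i + j)%N = n ->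
  tdegree_le n.-1 (P - 'X^(n - k) * 'Y ^+ k) -> P`_i`_j = (j == k)%:R.
Proof.
move=> n0 kn ijn hP.
have /eqP : (P - 'X^(n - k) * 'Y ^+ k)`_i`_j = 0.
  by apply/eqP/negPn/negP => /hP; lia.
rewrite !coefB coef_monomial subr_eq0 => /eqP ->.
by rewrite (_ : _ && _ = (j == k)) //; lia.
Qed.

Lemma tdegree_leSB n P T :
  tdegree_le n P -> tdegree_le n T ->
  (forall i j, (i + j)%N = n -> P`_i`_j = T`_i`_j) -> tdegree_le n.-1 (P - T).
Proof.
move=> hP hT PT i j PTij.
have /(_ i j PTij) := tdegree_leD hP (tdegree_leN hT).
rewrite leq_eqVlt => /orP[/eqP ijn|]; last by case: (n).
by move: PTij; rewrite !coefB PT// subrr eqxx.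
Qed.

Lemma tdegree0_const P : tdegree_le 0 P -> exists c : R, P = c%:P%:P.
Proof.
move=> hP; exists (P`_0`_0); have P0 i j : (0 < i + j)%N -> P`_i`_j = 0.
  by rewrite ltnNge => ij; apply/eqP; apply: contraNT ij => /hP.
apply/polyP => i; apply/polyP => j; rewrite coefC; case: i => [|i] /=.
  by rewrite coefC; case: j => //= j; rewrite P0.
by rewrite coef0 P0.
Qed.

End Bivariate.

(** * The tensor product of two linear forms *)

Section ProductFunctional.
Variables (R : realType) (La Lb : {scalar {poly R}}).
Implicit Types (f g : {poly R}) (P Q : {poly {poly R}}).

(** The algebraic counterpart of an iterated integral, with y integrated first. *)
Definition poly2_functional (P : {poly {poly R}}) : R := La (map_poly Lb P).

Local Notation LL := poly2_functional.

Lemma poly2_functionalD P Q : LL (P + Q) = LL P + LL Q.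
Proof. by rewrite /poly2_functional !raddfD. Qed.

Lemma poly2_functional_sum (I : finType) (F : I -> {poly {poly R}}) :
  LL (\sum_i F i) = \sum_i LL (F i).
Proof. by rewrite /poly2_functional !raddf_sum. Qed.

Lemma poly2_functionalM f g : LL (f^:P * g%:P) = La f * Lb g.
Proof.
rewrite /poly2_functional [map_poly _ _](_ : _ = Lb g *: f).
  by rewrite linearZ_LR mulrC.
apply/polyP => i; rewrite coef_map coefZ.
have -> : (f^:P * g%:P)`_i = f`_i *: g by rewrite coefMC coef_map mul_polyC.
by rewrite /= linearZ_LR mulrC.
Qed.

Lemma poly2_functionalZ (c : R) P : LL (c%:P%:P * P) = c * LL P.
Proof.
rewrite [P]poly2_sum mulr_sumr !poly2_functional_sum mulr_sumr.
apply: eq_bigr => i _; rewrite mulrCA -polyCM !poly2_functionalM mul_polyC.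
by rewrite linearZ_LR mulrCA.
Qed.

End ProductFunctional.

(** * Fubini for a product of two one-variable functions *)

Section ProductIntegral.
Variable R : realType.
Local Notation mu := (@lebesgue_measure R).

Lemma integrable_prod (F G : R -> R) :
  mu.-integrable setT (EFin \o F) -> mu.-integrable setT (EFin \o G) ->
  (mu \x mu)%E.-integrable setT (fun z : R * R => (F z.1 * G z.2)%:E) /\
  (\int[(mu \x mu)%E]_z (F z.1 * G z.2)%:E =
   (\int[mu]_x (F x)%:E) * (\int[mu]_x (G x)%:E))%E.
Proof.
move=> iF iG.
have mF : measurable_fun setT F by apply/measurable_EFinP; exact: measurable_int iF.
have mG : measurable_fun setT G by apply/measurable_EFinP; exact: measurable_int iG.
have mFG : measurable_fun setT (fun z : R * R => (F z.1 * G z.2)%:E).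
  apply/measurable_EFinP; apply: measurable_funM.
    exact: (measurableT_comp mF measurable_fst).
  exact: (measurableT_comp mG measurable_snd).
have iFG : (mu \x mu)%E.-integrable setT (fun z : R * R => (F z.1 * G z.2)%:E).
  apply/integrable12ltyP => //=.
  under eq_integral => x _.
    rewrite (_ : (fun y => _) = (fun y => `|F x|%:E * `|(G y)%:E|)%E); last first.
      by apply/funext => y; rewrite normrM EFinM.
    rewrite ge0_integralZl//; last first.
      by apply: measurableT_comp => //; apply/measurable_EFinP.
    over.
  rewrite /= ge0_integralZr//.
  - have /integrableP[_ lF] := iF; have /integrableP[_ lG] := iG.
    apply: lte_mul_pinfty => //; first exact: integral_ge0.
    by rewrite ge0_fin_numE//; exact: integral_ge0.
  - by apply/measurable_EFinP/measurableT_comp.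
  - exact: integral_ge0.
split=> //; rewrite -integral12_prod_meas1// /fubini_F /=.
under eq_integral => x _.
  rewrite (_ : (fun y => _) = (fun y => (F x)%:E * (G y)%:E)%E); last first.
    by apply/funext => y; rewrite EFinM.
  rewrite integralZl//; over.
have /fineK <- : (\int[mu]_x (G x)%:E)%E \is a fin_num by exact: integrable_fin_num.
by rewrite /= integralZr.
Qed.

End ProductIntegral.

(** * The weighted integral over the square as a tensor product of forms *)

Section Square.
Variables (R : realType) (a b : R).
Hypotheses (a_gt : - 2^-1 < a) (b_gt : - 2^-1 < b).
Local Notation mu := (@lebesgue_measure R).
Local Notation I := (`[(-1 : R), 1]%classic).

Local Notation LL := (poly2_functional (gint_linear a_gt) (gint_linear b_gt)).

(** Integrability accompanies the value because additivity of the integral requires it. *)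
Let wint (P : {poly {poly R}}) :=
  (mu \x mu)%E.-integrable (I `*` I) (fun z => (P.[z.1, z.2] * product_weight a b z)%:E) /\
  square_integral (fun z => P.[z.1, z.2] * product_weight a b z) = LL P.

Let wint_prod (f g : {poly R}) : wint (f^:P * g%:P).
Proof.
have iF := integrable_horner_weight a_gt f.
have iG := integrable_horner_weight b_gt g.
(* Extension by zero turns the integral over the square into one over the plane, where
   [integrable_prod] applies. *)
pose F := (fun x => f.[x] * gegenbauer_weight a x) \_ I.
pose G := (fun x => g.[x] * gegenbauer_weight b x) \_ I.
have mI : measurable I by exact: measurable_itv.
have iF' : mu.-integrable setT (EFin \o F).
  by rewrite /F -restrict_EFin; apply/integrable_restrict => //; rewrite setTI.
have iG' : mu.-integrable setT (EFin \o G).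
  by rewrite /G -restrict_EFin; apply/integrable_restrict => //; rewrite setTI.
have [iFG eFG] := integrable_prod iF' iG'.
have FGE : (fun z : R * R => ((f^:P * g%:P).[z.1, z.2] * product_weight a b z)%:E) \_ (I `*` I) =
    (fun z => (F z.1 * G z.2)%:E).
  apply/funext => -[x y]; rewrite patchE /F /G /= !patchE in_setX /=.
  case: (x \in I); case: (y \in I); rewrite /= ?mul0r ?mulr0//.
  congr EFin; rewrite /product_weight /= hornerM hornerC horner_map/=.
  by rewrite hornerM hornerC; ring.
split.
  have := iFG; rewrite -FGE => /integrable_restrict; rewrite setTI; apply=> //.
  exact: measurableX.
rewrite /square_integral /Rintegral integral_mkcond FGE eFG.
rewrite fineM ?integrable_fin_num// poly2_functionalM.
by congr (fine _ * fine _); rewrite [in RHS]integral_mkcond; apply: eq_integral => x _;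
  rewrite /F /G /= restrict_EFin.
Qed.

Let wintD P Q : wint P -> wint Q -> wint (P + Q).
Proof.
move=> [iP eP] [iQ eQ].
have PQE z : (P + Q).[z.1, z.2] * product_weight a b z =
   P.[z.1, z.2] * product_weight a b z + Q.[z.1, z.2] * product_weight a b z.
  by rewrite !hornerD mulrDl.
have mI : measurable (I `*` I) by apply: measurableX; exact: measurable_itv.
split.
  rewrite (_ : (fun z => _) = (fun z => (P.[z.1, z.2] * product_weight a b z)%:E +
      (Q.[z.1, z.2] * product_weight a b z)%:E)%E); first exact: integrableD.
  by apply/funext => z; rewrite PQE.
transitivity (square_integral (fun z => P.[z.1, z.2] * product_weight a b z) +
    square_integral (fun z => Q.[z.1, z.2] * product_weight a b z)); last first.
  by rewrite eP eQ poly2_functionalD.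
rewrite /square_integral -RintegralD; [|exact: mI|exact: iP|exact: iQ].
by congr Rintegral; apply/funext.
Qed.

Lemma square_integral_poly (P : {poly {poly R}}) :
  square_integral (fun z => P.[z.1, z.2] * product_weight a b z) = LL P.
Proof.
suff [] : wint P by [].
rewrite [P]poly2_sum.
elim/big_ind: _ => [|P' Q'|i _]; [|exact: wintD|exact: wint_prod].
(* The empty sum is written as a product of zero polynomials in x and in y, so that [wint_prod]
   covers it. *)
rewrite -[0](mul0r 0) -[X in wint (X * _)](rmorph0 (map_poly polyC)).
by rewrite -[X in wint (_ * X)]polyC0; exact: wint_prod.
Qed.

End Square.

(** * Monic orthogonal polynomials of a positive linear form *)

Section Orthogonal.
Variables (R : realType) (L : {scalar {poly R}}).
Hypothesis L_pos : forall f, f != 0 -> 0 < L (f ^+ 2).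

Definition monic_op (n : nat) (f : {poly R}) :=
  [/\ size f = n.+1, f \is monic &
      forall g : {poly R}, (size g <= n)%N -> L (f * g) = 0].

Lemma functional_eq0 (f : {poly R}) : L (f ^+ 2) = 0 -> f = 0.
Proof. by move=> f0; apply/eqP; apply: contraPT f0 => /L_pos/lt0r_neq0/eqP. Qed.

Variable p : nat -> {poly R}.
Hypothesis p_op : forall n, monic_op n (p n).

Lemma op_size n : size (p n) = n.+1. Proof. by case: (p_op n). Qed.

Lemma op_coef n : (p n)`_n = 1.
Proof. by case: (p_op n) => sp /monicP; rewrite lead_coefE sp. Qed.

Lemma op_coef_gt n k : (n < k)%N -> (p n)`_k = 0.
Proof. by move=> nk; rewrite nth_default// op_size. Qed.

Lemma op0 : p 0 = 1.
Proof.
apply/polyP => i; rewrite coef1; case: i => [|i]; first exact: op_coef.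
exact: op_coef_gt.
Qed.

Lemma op_ortho m n : m != n -> L (p m * p n) = 0.
Proof.
have H k l : (k < l)%N -> L (p l * p k) = 0.
  by case: (p_op l) => _ _ + kl; apply; rewrite op_size.
by rewrite neq_ltn => /orP[/H|/H//]; rewrite mulrC.
Qed.

End Orthogonal.

(** * The Gegenbauer differential equation and q_n' = n p_(n-1) *)

Section GegenbauerODE.
Variables (R : realType) (a : R) (L : {scalar {poly R}}).
Hypothesis a_gt : - 2^-1 < a.
Hypothesis L_pos : forall f, f != 0 -> 0 < L (f ^+ 2).
Hypothesis L_pearson : forall f, L (pearson a f) = 0.
Variable p : nat -> {poly R}.
Hypothesis p_op : forall n, monic_op L n (p n).

Let a2 : 0 < 1 + 2 * a.
Proof.
move: a_gt; rewrite -(ltr_pM2l (ltr0Sn R 1)) mulrN divff ?pnatr_eq0//.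
by rewrite -subr_gt0 opprK addrC.
Qed.

(** On f', [pearson] gives the Gegenbauer operator [(1 - x^2) f'' - (2 a + 1) x f']. Under [L] the
    left side vanishes, which makes this an integration by parts. *)
Lemma pearson_derivM (f g : {poly R}) :
  pearson a (f^`() * g) = pearson a f^`() * g + (1 - 'X^2) * f^`() * g^`().
Proof. by rewrite /pearson !derivM -!mul_polyC; ring. Qed.

(** Both sides equal [- L ((1 - x^2) f' g')]: the operator is self-adjoint. *)
Lemma pearson_deriv_sym (f g : {poly R}) :
  L (pearson a f^`() * g) = L (f * pearson a g^`()).
Proof.
have H u v : L (pearson a u^`() * v) = - L ((1 - 'X^2) * u^`() * v^`()).
  by apply/eqP; rewrite -addr_eq0 -linearD -pearson_derivM L_pearson.
by rewrite H mulrC (mulrC f) H mulrC -!mulrA (mulrC f^`()).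
Qed.

Lemma coef_deriv_natl (f : {poly R}) k : f^`()`_k = k.+1%:R * f`_k.+1.
Proof. by rewrite coef_deriv mulr_natl. Qed.

Lemma coef_pearson_deriv (f : {poly R}) k :
  (pearson a f^`())`_k =
    k.+2%:R * k.+1%:R * f`_k.+2 - k%:R * (k%:R + 2 * a) * f`_k.
Proof.
rewrite /pearson mulrBl mul1r !coefB coefZ coefXM coefXnM !coef_deriv_natl.
case: k => [|[|k]] /=; rewrite ?coef_deriv_natl ?subSS ?subn0 -?natr1; ring.
Qed.

(** The eigenvalue is chosen so that the left side [E] has degree below [n]. By self-adjointness
    [L (E^2)] pairs [p n] only with polynomials of degree below [n], so it is 0, and positivity
    gives [E = 0]. *)
Lemma gegenbauer_ode n :
  pearson a (p n)^`() + (n%:R * (n%:R + 2 * a)) *: p n = 0.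
Proof.
set E := _ + _.
have sE : (size E <= n)%N.
  apply/leq_sizeP => k nk; rewrite coefD coefZ coef_pearson_deriv.
  rewrite (op_coef_gt p_op (leq_trans (leqnn n.+1) _)); last by rewrite ltnS (leq_trans nk).
  case: ltngtP nk => // [nk|<-] _; last by ring.
  by rewrite (op_coef_gt p_op nk); ring.
apply: (functional_eq0 L_pos); rewrite expr2 {1}/E mulrDl linearD /=.
have [_ _ po] := p_op n.
rewrite pearson_deriv_sym po; last first.
  apply/leq_sizeP => k nk; rewrite coef_pearson_deriv !nth_default ?mulr0 ?subrr//.
    exact: leq_trans sE nk.
  by rewrite (leq_trans sE)// (leq_trans nk)// -addn2 leq_addr.
by rewrite -scalerAl linearZ_LR /= po// mulr0 addr0.
Qed.

Lemma gegenbauer_coef_rec n k :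
  (n%:R - k%:R) * (n%:R + k%:R + 2 * a) * (p n)`_k +
  k.+2%:R * k.+1%:R * (p n)`_k.+2 = 0.
Proof.
have /polyP/(_ k) := gegenbauer_ode n.
rewrite coefD coefZ coef_pearson_deriv coef0.
move: (_.+2%:R * _) ((p n)`_k) ((p n)`_k.+2) => u c c2 H.
by rewrite -[RHS]H; ring.
Qed.

(** Descending induction on [k] in steps of two. With [Z] the coefficients of the difference of two
    sides of an identity, only the indices from [N] on remain to be compared. *)
Lemma coef_rec_eq0 (N : nat) (F Z : nat -> R) :
  (forall k, (N <= k)%N -> Z k = 0) ->
  (forall k, F k * Z k = - (k.+2%:R * k.+1%:R * Z k.+2)) ->
  (forall k, (k < N)%N -> F k != 0) ->
  forall k, Z k = 0.
Proof.
move=> ZN FZ F0 k.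
have [j] := ubnP (N - k); elim: j k => // j IH k Nk.
have [|kN] := leqP N k; first exact: ZN.
apply: (mulfI (F0 _ kN)); rewrite mulr0 FZ IH ?mulr0 ?oppr0//; lia.
Qed.

Let gt0_2a (j : R) : 0 <= j -> 0 < j + 1 + 2 * a.
Proof. by move=> j0; rewrite -addrA ltr_wpDl. Qed.

Let subn_neq0 (m k : nat) : (k < m)%N -> m%:R - k%:R != 0 :> R.
Proof. by move=> km; rewrite subr_eq0 eqr_nat gtn_eqF. Qed.

(** In the recurrence at [k = n] the term with index [n + 2] is zero, and the factor [2 n + 1 + 2 a]
    is positive. *)
Lemma op_coef_pred n : (p n.+1)`_n = 0.
Proof.
have := gegenbauer_coef_rec n.+1 n.
rewrite (op_coef_gt p_op (ltnSn _)) mulr0 addr0 => /eqP; rewrite !mulf_eq0 => /orP[/orP[|]|/eqP//].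
  by rewrite (negbTE (subn_neq0 (ltnSn n))).
rewrite gt_eqF// (_ : _ + _ = (n%:R + n%:R) + 1 + 2 * a); last by rewrite -natr1; ring.
by apply: gt0_2a; rewrite addr_ge0.
Qed.

(* Coefficients of
   [2 (m + 1 + a) p_(m+2)' = (m + 2) (x p_(m+1)' + (m + 1 + 2 a) p_(m+1))]. *)
Lemma op_deriv_up m k :
  (2 * m%:R + 2 + 2 * a) * (k.+1%:R * (p m.+2)`_k.+1) =
  m.+2%:R * ((m.+1%:R + k%:R + 2 * a) * (p m.+1)`_k).
Proof.
apply/eqP; rewrite -subr_eq0; apply/eqP.
pose Z k := (2 * m%:R + 2 + 2 * a) * (k.+1%:R * (p m.+2)`_k.+1) -
  m.+2%:R * ((m.+1%:R + k%:R + 2 * a) * (p m.+1)`_k).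
(* The factor is that of [gegenbauer_coef_rec] for [p m.+2] at [k.+1]. It vanishes at [k = m + 1],
   so that index is settled by leading coefficients. *)
apply: (@coef_rec_eq0 m.+1 (fun k => (m.+1%:R - k%:R) * (m.+1%:R + k%:R + 2 + 2 * a)) Z) => {}k.
- rewrite leq_eqVlt => /orP[/eqP<-|mk]; rewrite /Z.
    by rewrite !(op_coef p_op) -!natr1; ring.
  by rewrite (op_coef_gt p_op mk) (op_coef_gt p_op (_ : m.+2 < k.+1)%N)//; ring.
- have H1 := gegenbauer_coef_rec m.+2 k.+1.
  have H2 := gegenbauer_coef_rec m.+1 k.
  rewrite /Z; move: H1 H2; rewrite -!natr1.
  move: (m%:R : R) (k%:R : R) ((p m.+2)`_k.+1) ((p m.+2)`_k.+3).
  move: ((p m.+1)`_k) ((p m.+1)`_k.+2) => d0 d2 M K c1 c3.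
  set e1 := (X in X = 0 -> _) => H1; set e2 := (X in X = 0 -> _) => H2; apply/subr0_eq.
  (* The recurrence of [Z] is a linear combination of the recurrences of [p m.+2] and [p m.+1]. *)
  transitivity ((2 * M + 2 + 2 * a) * (K + 1) * e1 -
    (M + 1 + 1) * (M + 1 + K + 2 + 2 * a) * e2); first by rewrite /e1 /e2; ring.
  by rewrite H1 H2; ring.
- move=> km; rewrite mulf_neq0 ?subn_neq0// gt_eqF//.
  rewrite (_ : _ + _ = (m.+1%:R + k%:R + 1) + 1 + 2 * a); last by ring.
  by apply: gt0_2a; rewrite !addr_ge0.
Qed.

(* Coefficients of
   [(m + 1) p_m' = - 2 (m + a) ((m + 1) p_(m+1) - x p_(m+1)')]. *)
Lemma op_deriv_down m k :
  m.+1%:R * (k.+1%:R * (p m)`_k.+1) +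
  2 * (m%:R + a) * ((m.+1%:R - k%:R) * (p m.+1)`_k) = 0.
Proof.
pose Z k := m.+1%:R * (k.+1%:R * (p m)`_k.+1) +
  2 * (m%:R + a) * ((m.+1%:R - k%:R) * (p m.+1)`_k).
(* The factor is that of [p m] at [k.+1]. It vanishes at [k = m - 1], where [Z] is computed from the
   recurrence of [p m.+1] instead. *)
apply: (@coef_rec_eq0 m.-1 (fun k => (m%:R - 1 - k%:R) * (m%:R + k%:R + 1 + 2 * a)) Z) => {}k.
- rewrite /Z => mk; have [mk1|mk1|mk1] := ltngtP m k.+1.
  + rewrite (op_coef_gt p_op mk1); move: mk1; rewrite ltnS leq_eqVlt => /orP[/eqP<-|].
      by rewrite op_coef_pred; ring.
    rewrite leq_eqVlt => /orP[/eqP<-|mk1]; first by ring.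
    by rewrite (op_coef_gt p_op mk1); ring.
  + by move: mk1 mk; case: (m) => //= n; rewrite ltnS => /leq_trans h /h; rewrite ltnn.
  + have := gegenbauer_coef_rec m.+1 k; rewrite mk1 !(op_coef p_op) -!natr1.
    move: (k%:R : R) ((p k.+2)`_k) => K c; set e := (X in X = 0 -> _) => H.
    by rewrite -[RHS]H /e; ring.
- have H1 := gegenbauer_coef_rec m k.+1.
  have H2 := gegenbauer_coef_rec m.+1 k.
  rewrite /Z; move: H1 H2; rewrite -!natr1.
  move: (m%:R : R) (k%:R : R) ((p m)`_k.+1) ((p m)`_k.+3).
  move: ((p m.+1)`_k) ((p m.+1)`_k.+2) => d0 d2 M K c1 c3.
  set e1 := (X in X = 0 -> _) => H1; set e2 := (X in X = 0 -> _) => H2; apply/subr0_eq.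
  transitivity ((M + 1) * (K + 1) * e1 + 2 * (M + a) * (M - 1 - K) * e2).
    by rewrite /e1 /e2; ring.
  by rewrite H1 H2; ring.
- move=> km; have m0 : (0 < m)%N by case: (m) km.
  apply: mulf_neq0; last by rewrite gt_eqF// gt0_2a// addr_ge0.
  by rewrite -(natrB _ m0) subn1 subn_neq0.
Qed.

(** [op_deriv_up] and [op_deriv_down] express p_(m+2)' and p_m' through p_(m+1) and x p_(m+1)'. The
    coefficient [gegenbauer_b] is the one for which the terms in x p_(m+1)' cancel. *)
Lemma deriv_gegenbauer_q n : (gegenbauer_q a p n.+1)^`() = n.+1%:R *: p n.
Proof.
case: n => [|m] /=.
  apply/polyP => i; rewrite scale1r coef_deriv_natl (op0 p_op) coef1; case: i => [|i].
    by rewrite (op_coef p_op) mulr1.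
  by rewrite (op_coef_gt p_op)// mulr0.
apply/polyP => k; rewrite derivD derivZ coefD !coefZ !coef_deriv_natl.
have U := op_deriv_up m k; have D := op_deriv_down m k.
have m1a : 2 * m%:R + 2 + 2 * a != 0.
  rewrite gt_eqF// (_ : _ + _ = (2 * m%:R + 1) + 1 + 2 * a); last by ring.
  by apply: gt0_2a; rewrite addr_ge0// mulr_ge0.
apply: (mulfI m1a); rewrite mulrDr U /gegenbauer_b.
(* [m = 0] is separate because [b_1] is the junk value 0 at [a = 0]. *)
case: m => [|m] in U D m1a *.
  rewrite (op_coef_gt p_op (ltn0Sn k)) !mulr0 addr0.
  case: k => [|[|k]] in U D *; rewrite ?op_coef_pred ?(op_coef p_op); try by ring.
  by rewrite (op_coef_gt p_op)//; ring.
have ma : m%:R + 1 + a != 0.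
  rewrite -(mulrI_eq0 _ (mulfI (_ : 2 != 0 :> R))) ?pnatr_eq0// gt_eqF//.
  rewrite (_ : _ * _ = (2 * m%:R + 1) + 1 + 2 * a); last by ring.
  by apply: gt0_2a; rewrite addr_ge0// mulr_ge0.
have ma1 : m%:R + 1 + 1 + a != 0.
  rewrite -(mulrI_eq0 _ (mulfI (_ : 2 != 0 :> R))) ?pnatr_eq0// gt_eqF//.
  rewrite (_ : _ * _ = (2 * m%:R + 1 + 2) + 1 + 2 * a); last by ring.
  by apply: gt0_2a; rewrite !addr_ge0// mulr_ge0.
have m2 : m%:R + 1 + 1 != 0 :> R by rewrite !natr1 pnatr_eq0.
have -> : k.+1%:R * (p m.+1)`_k.+1 =
    - (2 * (m.+1%:R + a) * ((m.+2%:R - k%:R) * (p m.+2)`_k)) / m.+2%:R.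
  apply: (canRL (mulfK _)); first by rewrite pnatr_eq0.
  by move/eqP: D; rewrite addr_eq0 mulrC => /eqP.
rewrite -!natr1; field.
by rewrite m2 ma1 andbT /= (_ : _ - 1 = m%:R + 1 + a) ?ma//; ring.
Qed.

End GegenbauerODE.

(** * The gradient form: positivity, and definiteness modulo constants *)

Section SobolevInner.
Variables (R : realType) (La Lb : {scalar {poly R}}).
Hypothesis La_pos : forall f : {poly R}, f != 0 -> 0 < La (f ^+ 2).
Hypothesis Lb_pos : forall f : {poly R}, f != 0 -> 0 < Lb (f ^+ 2).
Variable p : nat -> {poly R}.
Hypothesis p_op : forall n, monic_op La n (p n).

Local Notation LL := (poly2_functional La Lb).
Implicit Types (f g : {poly R}) (P Q : {poly {poly R}}).

(** Induction on the degree in x. Subtracting [c(y) p_m(x)], with [c] the leading coefficient in x,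
    leaves a [Z] of smaller degree; the cross term vanishes by orthogonality of [p m], so the square
    splits into [La (p_m^2) Lb (c^2)], which is positive, plus that of [Z]. *)
Lemma poly2_functional_pos P : P != 0 -> 0 < LL (P ^+ 2).
Proof.
have [n] := ubnP (size P); elim: n P => // n IH P sP P0.
pose m := (size P).-1; pose c := lead_coef P.
have sPm : size P = m.+1 by rewrite prednK// lt0n size_poly_eq0.
have [sp _ po] := p_op m.
pose Z := P - (p m)^:P * c%:P.
have sZ : (size Z <= m)%N.
  apply/leq_sizeP => i; rewrite leq_eqVlt => /orP[/eqP<-|mi].
    rewrite coefB coefMC coef_map/= (op_coef p_op) /c lead_coefE -/m.
    by rewrite polyC1 mul1r subrr.
  by rewrite coefB coefMC coef_map/= (op_coef_gt p_op mi) nth_default ?sPm// polyC0 mul0r subr0.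
have LZ : 0 <= LL (Z ^+ 2).
  have [->|Z0] := eqVneq Z 0.
    by rewrite expr0n /= /poly2_functional !raddf0.
  by apply/ltW/IH => //; rewrite (leq_ltn_trans sZ)// -ltnS -sPm.
have PZ : P ^+ 2 = (p m ^+ 2)^:P * (c ^+ 2)%:P + (Z ^+ 2 + 2%:P%:P * ((p m)^:P * c%:P * Z)).
  by rewrite /Z !rmorphXn /= polyCMn polyC1 polyCMn polyC1; ring.
have LpZ : LL ((p m)^:P * c%:P * Z) = 0.
  rewrite [Z]poly2_sum mulr_sumr poly2_functional_sum big1// => i _.
  rewrite mulrACA -rmorphM -polyCM poly2_functionalM po ?mul0r//.
  by rewrite size_polyXn (leq_trans (ltn_ord i)).
rewrite PZ !poly2_functionalD poly2_functionalZ LpZ mulr0 addr0 poly2_functionalM.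
rewrite ltr_pwDl// mulr_gt0// ?La_pos ?Lb_pos// ?lead_coef_eq0//.
by rewrite -size_poly_eq0 sp.
Qed.

Definition grad_ip P Q : R := (LL 1)^-1 * LL (dx P * dx Q + dy P * dy Q).

Lemma poly2_functional1_gt0 : 0 < LL 1.
Proof. by rewrite -(expr1n _ 2); apply: poly2_functional_pos; rewrite oner_eq0. Qed.

Lemma grad_ipC P Q : grad_ip P Q = grad_ip Q P.
Proof. by rewrite /grad_ip (mulrC (dx P)) (mulrC (dy P)). Qed.

Lemma grad_ipD P P' Q : grad_ip (P + P') Q = grad_ip P Q + grad_ip P' Q.
Proof.
rewrite /grad_ip /dx /dy derivD raddfD /= !mulrDl addrACA poly2_functionalD.
by rewrite mulrDr.
Qed.

Lemma grad_ipZ (c : R) P Q : grad_ip (c%:P%:P * P) Q = c * grad_ip P Q.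
Proof.
have dyZ : dy (c%:P%:P * P) = c%:P%:P * dy P.
  apply/polyP => i; rewrite /dy coef_map !coefCM coef_map/= derivM derivC.
  by rewrite mul0r add0r.
rewrite /grad_ip dyZ /dx derivM derivC mul0r add0r -!mulrA -mulrDr.
by rewrite poly2_functionalZ mulrCA.
Qed.

Lemma grad_ip_const (c : R) Q : grad_ip c%:P%:P Q = 0.
Proof.
rewrite /grad_ip /dx derivC /dy map_polyC /= derivC polyC0 !mul0r addr0.
by rewrite /poly2_functional !raddf0 mulr0.
Qed.

Lemma grad_ip_eq0 P : grad_ip P P = 0 -> exists c : R, P = c%:P%:P.
Proof.
have LLge0 Q : 0 <= LL (Q * Q).
  have [->|Q0] := eqVneq Q 0; last exact/ltW/poly2_functional_pos.
  by rewrite mulr0 /poly2_functional !raddf0.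
have LLeq0 Q : LL (Q * Q) = 0 -> Q = 0.
  by move=> Q0; apply/eqP; apply: contraPT Q0 => /poly2_functional_pos/lt0r_neq0/eqP.
move/eqP; rewrite /grad_ip mulf_eq0 invr_eq0 gt_eqF ?poly2_functional1_gt0//=.
rewrite poly2_functionalD paddr_eq0// => /andP[/eqP/LLeq0/polyP dx0 /eqP/LLeq0/polyP dy0].
have c0 (h : {poly R}) : h^`() = 0 -> h = (h`_0)%:P.
  move=> /polyP h0; apply/polyP => j; rewrite coefC; case: j => // j.
  by have /eqP := h0 j; rewrite coef_deriv coef0 mulrn_eq0 => /eqP.
exists (P`_0`_0); apply/polyP => i; rewrite coefC; case: i => [|i] /=.
  by apply: c0; have := dy0 0%N; rewrite coef_map coef0.
have /polyP := dx0 i; rewrite coef_deriv coef0 => h; apply/polyP => j.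
by have /eqP := h j; rewrite coefMn coef0 mulrn_eq0 => /eqP.
Qed.

End SobolevInner.

(** * Relation and recursion for a symmetric form that is definite modulo constants *)

Section Recursion.
Variables (R : realType) (ip : {poly {poly R}} -> {poly {poly R}} -> R).
Hypothesis ipC : forall P P' : {poly {poly R}}, ip P P' = ip P' P.
Hypothesis ipD : forall P P' T : {poly {poly R}}, ip (P + P') T = ip P T + ip P' T.
Hypothesis ipZ : forall (c : R) (P T : {poly {poly R}}), ip (c%:P%:P * P) T = c * ip P T.
Hypothesis ip_const : forall (c : R) T, ip c%:P%:P T = 0.
Hypothesis ip_eq0 : forall P, ip P P = 0 -> exists c : R, P = c%:P%:P.
Variables Q S : forall n, 'cV[{poly {poly R}}]_n.+1.
Hypothesis Q_monic : forall n (k : 'I_n.+1),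
  tdegree_le n.-1 (Q n k 0 - 'X^(n - k) * 'Y ^+ k).
Hypothesis Q_ortho : forall n m (k : 'I_n.+1) (l : 'I_m.+1),
  [&& n != m, n != m.+2 & m != n.+2] -> ip (Q n k 0) (Q m l 0) = 0.
Hypothesis S_monic : forall n (k : 'I_n.+1), (0 < n)%N ->
  tdegree_le n.-1 (S n k 0 - 'X^(n - k) * 'Y ^+ k).
Hypothesis S_ortho : forall n (k : 'I_n.+1) g, (0 < n)%N ->
  tdegree_le n.-1 g -> ip (S n k 0) g = 0.
Implicit Types P T : {poly {poly R}}.

Definition gram m n (F : 'cV[{poly {poly R}}]_m) (G : 'cV[{poly {poly R}}]_n) : 'M[R]_(m, n) :=
  \matrix_(i, j) ip (F i 0) (G j 0).

Lemma ip0l T : ip 0 T = 0.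
Proof. by have := ip_const 0 T; rewrite !polyC0. Qed.

Lemma ipN P T : ip (- P) T = - ip P T.
Proof. by apply/eqP; rewrite -addr_eq0 -ipD addNr ip0l. Qed.

Lemma ipB P P' T : ip (P - P') T = ip P T - ip P' T.
Proof. by rewrite ipD ipN. Qed.

Lemma ip_sum (I : finType) (F : I -> {poly {poly R}}) T :
  ip (\sum_i F i) T = \sum_i ip (F i) T.
Proof. by elim/big_rec2: _ => [|i x P _ <-]; rewrite ?ip0l ?ipD. Qed.

Lemma real_mulmxE m n (B : 'M[R]_(m, n)) (F : 'cV_n) i :
  real_mulmx B F i 0 = \sum_j (B i j)%:P%:P * F j 0.
Proof. by rewrite /real_mulmx mxE; apply: eq_bigr => j _; rewrite mxE. Qed.

Lemma gramT m n (F : 'cV_m) (G : 'cV_n) : (gram F G)^T = gram G F.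
Proof. by apply/matrixP => i j; rewrite !mxE ipC. Qed.

Lemma gramD m n (F F' : 'cV_m) (G : 'cV_n) : gram (F + F') G = gram F G + gram F' G.
Proof. by apply/matrixP => i j; rewrite !mxE ipD. Qed.

Lemma gram_mulmx l m n (B : 'M[R]_(l, m)) (F : 'cV_m) (G : 'cV_n) :
  gram (real_mulmx B F) G = B *m gram F G.
Proof.
apply/matrixP => i j; rewrite [LHS]mxE [RHS]mxE real_mulmxE ip_sum.
by apply: eq_bigr => k _; rewrite ipZ mxE.
Qed.

Lemma gram_const m n (F F' : 'cV_m) (G : 'cV_n) :
  eq_upto_const F F' -> gram F G = gram F' G.
Proof.
move=> FF'; apply/matrixP => i j; rewrite !mxE; have [c] := FF' i.
by move/(canRL (subrK _)) => ->; rewrite ipD ip_const add0r.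
Qed.

Lemma Q_tdegree n (k : 'I_n.+1) : tdegree_le n (Q n k 0).
Proof. by apply: (@tdegree_le_monic _ n k); [rewrite -ltnS|exact: Q_monic]. Qed.

Lemma S_tdegree n (k : 'I_n.+1) : (0 < n)%N -> tdegree_le n (S n k 0).
Proof. by move=> n0; apply: (@tdegree_le_monic _ n k); [rewrite -ltnS|exact: S_monic]. Qed.

(** The [Q m] with [m <= N] span the polynomials of degree at most [N], by induction on [N]. *)
Lemma ortho_tdegree F N : (forall m (l : 'I_m.+1), (m <= N)%N -> ip F (Q m l 0) = 0) ->
  forall P, tdegree_le N P -> ip F P = 0.
Proof.
elim: N => [|N IH] FQ P hP.
  by have [c ->] := tdegree0_const hP; rewrite ipC ip_const.
(* [T] has the same part of degree [N + 1] as [P], because [Q N.+1 l 0] has leading monomial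
   [x^(N+1-l) y^l]. *)
pose T := \sum_(l < N.+2) (P`_(N.+1 - l)`_l)%:P%:P * Q N.+1 l 0.
rewrite -(subrK T P) ipC ipD ipC IH ?add0r.
- by rewrite /T ip_sum big1// => l _; rewrite ipZ ipC FQ ?mulr0.
- by move=> m l mN; apply: FQ; exact: leqW.
apply: (@tdegree_leSB _ N.+1) => //.
  by apply: tdegree_le_sum => l; apply: tdegree_leZ; exact: Q_tdegree.
move=> i j ijN; rewrite /T !coef_sum.
have jN : (j < N.+2)%N by rewrite ltnS -ijN leq_addl.
have QE (l : 'I_N.+2) : (Q N.+1 l 0)`_i`_j = (j == l)%:R.
  have := @Q_monic N.+1 l; have lN := ltn_ord l.
  exact: (@coef_monic _ N.+1 l i j _ isT lN ijN).
rewrite (bigD1 (Ordinal jN))//= big1 ?addr0.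
  by rewrite !coefCM QE eqxx mulr1 -ijN addnK.
move=> l lj; rewrite !coefCM QE (_ : j == l = false) ?mulr0//.
by apply: contraNF lj => /eqP jl; apply/eqP/val_inj.
Qed.

Lemma const_of_ortho N P : tdegree_le N P ->
  (forall m (l : 'I_m.+1), (m <= N)%N -> ip P (Q m l 0) = 0) ->
  exists c : R, P = c%:P%:P.
Proof. by move=> hP PQ; apply: ip_eq0; exact: ortho_tdegree PQ P hP. Qed.

Lemma QS_tdegree n (k : 'I_n.+1) : (0 < n)%N -> tdegree_le n.-1 (Q n k 0 - S n k 0).
Proof.
move=> n0; pose M : {poly {poly R}} := 'X^(n - k) * 'Y ^+ k.
rewrite (_ : _ - _ = (Q n k 0 - M) + - (S n k 0 - M)).
  by apply: tdegree_leD; [exact: Q_monic|apply: tdegree_leN; exact: S_monic].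
by rewrite opprB addrA subrK.
Qed.

Lemma gram_SQ n m : (m < n)%N -> gram (S n) (Q m) = 0.
Proof.
move=> mn; apply/matrixP => i j; rewrite !mxE; apply: S_ortho.
  exact: leq_ltn_trans mn.
by apply: (@tdegree_leW _ m); [rewrite -ltnS prednK//; exact: leq_ltn_trans mn|exact: Q_tdegree].
Qed.

Lemma gram_SS n m : (0 < m)%N -> (m < n)%N -> gram (S n) (S m) = 0.
Proof.
move=> m0 mn; apply/matrixP => i j; rewrite !mxE; apply: S_ortho.
  exact: leq_ltn_trans mn.
by apply: (@tdegree_leW _ m); [rewrite -ltnS prednK//; exact: leq_ltn_trans mn|exact: S_tdegree].
Qed.

Lemma gram_SQn n : (0 < n)%N -> gram (S n) (Q n) = gram (S n) (S n).
Proof.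
move=> n0; apply/matrixP => i j; rewrite !mxE; apply/eqP; rewrite -subr_eq0.
by rewrite ![ip (S n i 0) _]ipC -ipB ipC S_ortho//; exact: QS_tdegree.
Qed.

Lemma gram_QQ n m : [&& n != m, n != m.+2 & m != n.+2] -> gram (Q n) (Q m) = 0.
Proof. by move=> nm; apply/matrixP => i j; rewrite !mxE Q_ortho. Qed.

(** [S n] and [Q n] differ in degree at most [n - 1], and [Q n.+2] is orthogonal to every [Q m] with
    [m < n]. *)
Lemma gram_Q2S n : (0 < n)%N -> gram (Q n.+2) (S n) = gram (Q n.+2) (Q n).
Proof.
move=> n0; apply/matrixP => i j; rewrite !mxE; apply/esym/eqP; rewrite -subr_eq0.
rewrite ![ip (Q n.+2 i 0) _]ipC -ipB ipC (@ortho_tdegree _ n.-1) => [//|m l mn|].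
  by apply: Q_ortho; apply/and3P; split; apply/eqP; lia.
exact: QS_tdegree.
Qed.

(** A row vector [v] in the kernel makes the combination of the [S n] with coefficients [v] have
    norm zero, so it is constant. Its coefficient at [x^(n-k) y^k] is the k-th entry of [v], which
    is therefore 0 as [n > 0]. *)
Lemma gram_S_unit n : (0 < n)%N -> gram (S n) (S n) \in unitmx.
Proof.
move=> n0; rewrite -row_free_unit -kermx_eq0; apply/eqP/row_matrixP => i0.
rewrite row0; set v := row i0 _.
have vH : v *m gram (S n) (S n) = 0 by apply/sub_kermxP; exact: row_sub.
have [c vc] : exists c : R, real_mulmx v (S n) 0 0 = c%:P%:P.
  apply: ip_eq0.
  have <- : gram (real_mulmx v (S n)) (real_mulmx v (S n)) 0 0 =
    ip (real_mulmx v (S n) 0 0) (real_mulmx v (S n) 0 0) by rewrite mxE.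
  by rewrite gram_mulmx -gramT gram_mulmx vH trmx0 mulmx0 mxE.
apply/rowP => k; rewrite [RHS]mxE.
have kn : (k <= n)%N by rewrite -ltnS.
have := congr1 (fun P : {poly {poly R}} => P`_(n - k)`_k) vc.
have -> : (c%:P%:P : {poly {poly R}})`_(n - k)`_k = 0.
  by rewrite coefC; case: ifP => [/eqP nk|_]; rewrite ?coef0// coefC; case: eqP => // k0; lia.
rewrite real_mulmxE => <-; rewrite !coef_sum (bigD1 k)//= big1 ?addr0.
  rewrite !coefCM (@coef_monic _ n k) ?eqxx ?mulr1 ?subnK//; exact: S_monic.
move=> l lk; rewrite !coefCM (@coef_monic _ n l) ?subnK//; last exact: S_monic.
  rewrite (_ : (k == l :> nat) = false) ?mulr0//.
  by apply: contraNF lk => /eqP kl; apply/eqP/val_inj.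
by rewrite -ltnS.
Qed.

(** The parity invariant. [Q_relation] applies it at [m = n + 1]; its induction from [n] to [n + 2]
    calls for larger odd gaps. *)
Definition odd_ortho n := forall m, (n < m)%N -> odd (m - n) -> gram (S n) (Q m) = 0.

Lemma odd_ortho_of_gram n (F : 'cV_n.+1) : eq_upto_const (S n) F ->
  (forall m, (n < m)%N -> odd (m - n) -> gram F (Q m) = 0) -> odd_ortho n.
Proof. by move=> SF hF m nm om; rewrite (gram_const _ SF) hF. Qed.

Lemma eq_upto_const_sym n (F G : 'cV[{poly {poly R}}]_n) :
  eq_upto_const F G -> eq_upto_const G F.
Proof. by move=> FG i; have [c e] := FG i; exists (- c); rewrite -opprB e -!polyCN. Qed.

(** For [n <= 2] the only lower vector at distance 2 from [Q n] is [Q 0], which is constant and so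
    orthogonal to everything. *)
Lemma S_const_Q n : (0 < n)%N -> (n <= 2)%N -> eq_upto_const (S n) (Q n).
Proof.
move=> n0 n2; apply: eq_upto_const_sym => i.
apply: (@const_of_ortho n.-1); first exact: QS_tdegree.
move=> [|m] l mn.
  by have [c ->] := tdegree0_const (@Q_tdegree 0 l); rewrite ipC ip_const.
rewrite ipB Q_ortho; last by apply/and3P; split; apply/eqP; lia.
have -> : ip (S n i 0) (Q m.+1 l 0) = gram (S n) (Q m.+1) i l by rewrite mxE.
by rewrite gram_SQ ?mxE ?subr0//; lia.
Qed.

(** The difference has degree at most [n + 1], so it is tested against the [Q m] with [m <= n + 1]:
    all terms vanish for [m < n], the choice of [B] settles [m = n], and parity settles
    [m = n + 1]. *)
Lemma Q_relation n : (0 < n)%N -> odd_ortho n ->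
  eq_upto_const (Q n.+2)
    (S n.+2 + real_mulmx (gram (Q n.+2) (Q n) *m invmx (gram (S n) (S n))) (S n)).
Proof.
move=> n0 on i; set B := _ *m _.
apply: (@const_of_ortho n.+1) => [|m l mn].
  rewrite mxE opprD addrA; apply: tdegree_leD; first exact: (@QS_tdegree n.+2).
  apply: tdegree_leN; rewrite real_mulmxE; apply: tdegree_le_sum => j.
  by apply: tdegree_leZ; apply: (@tdegree_leW _ n) => //; exact: S_tdegree.
rewrite ipB.
have -> : ip (Q n.+2 i 0) (Q m l 0) = gram (Q n.+2) (Q m) i l by rewrite mxE.
have -> : ip ((S n.+2 + real_mulmx B (S n)) i 0) (Q m l 0) =
  gram (S n.+2 + real_mulmx B (S n)) (Q m) i l by rewrite [RHS]mxE.
rewrite gramD gram_mulmx gram_SQ// add0r.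
have [mn'|nm|mn'] := ltngtP m n.
- rewrite gram_SQ// mulmx0 gram_QQ ?mxE ?subr0//.
  by apply/and3P; split; apply/eqP; lia.
- have {mn nm} mn : m = n.+1 by lia.
  subst m; rewrite on ?mulmx0 ?gram_QQ ?mxE ?subr0//; last by rewrite subSnn.
  by apply/and3P; split; apply/eqP; lia.
- by subst m; rewrite gram_SQn// mulmxKV ?subrr// gram_S_unit.
Qed.

(** Up to constants, [S n] is [Q n] for [n <= 2], and [S n.+2] is [Q n.+2] minus a combination of
    [S n]; both pieces are orthogonal to [Q m] at odd distance. *)
Lemma S_odd_ortho n : (0 < n)%N -> odd_ortho n.
Proof.
have [k] := ubnP n; elim: k n => // k IH n nk n0.
have [n2|n2] := leqP n 2.
  apply: (odd_ortho_of_gram (S_const_Q n0 n2)) => m nm om.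
  by apply: gram_QQ; apply/and3P; split; apply/eqP; lia.
case: n => [|[|n]] // in nk n0 n2 *; have {n0 n2} n0 : (0 < n)%N by lia.
have on : odd_ortho n by apply: IH; lia.
have /eq_upto_const_sym rel := Q_relation n0 on.
move=> m nm om.
have : gram (S n.+2 + real_mulmx (gram (Q n.+2) (Q n) *m invmx (gram (S n) (S n))) (S n)) (Q m) = 0.
  rewrite (gram_const _ rel).
  by apply: gram_QQ; apply/and3P; split; apply/eqP; lia.
rewrite gramD gram_mulmx on ?mulmx0 ?addr0//; lia.
Qed.

(** For uniqueness, pairing the relation with [S n] removes [S n.+2] and leaves [B] times an
    invertible Gram matrix. *)
Lemma Q_relationP n (B : 'M[R]_(n.+3, n.+1)) : (0 < n)%N ->
  eq_upto_const (Q n.+2) (S n.+2 + real_mulmx B (S n)) <->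
  B = gram (Q n.+2) (Q n) *m invmx (gram (S n) (S n)).
Proof.
move=> n0; split=> [rel|->]; last by apply: Q_relation => //; exact: S_odd_ortho.
rewrite -gram_Q2S// (gram_const _ rel) gramD gram_mulmx gram_SS// add0r.
by rewrite mulmxK// gram_S_unit.
Qed.

(** Pairing the relation with [Q n.+2] gives [D = H + B C^T], as [S n.+2] pairs with [Q n.+2] as
    with itself. *)
Lemma gram_S_recursion n : (0 < n)%N ->
  gram (S n.+2) (S n.+2) = gram (Q n.+2) (Q n.+2) -
    gram (Q n.+2) (Q n) *m invmx (gram (S n) (S n)) *m (gram (Q n.+2) (Q n))^T.
Proof.
move=> n0; set B := _ *m invmx _.
have rel : eq_upto_const (Q n.+2) (S n.+2 + real_mulmx B (S n)) by apply/Q_relationP.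
rewrite [X in X - _](gram_const _ rel) gramD gram_mulmx gram_SQn//.
by rewrite -gram_Q2S// gramT addrK.
Qed.

Lemma gram_S_initial n : (0 < n)%N -> (n <= 2)%N -> gram (S n) (S n) = gram (Q n) (Q n).
Proof.
move=> n0 n2; have SQ := S_const_Q n0 n2.
by rewrite (gram_const _ SQ) -gramT (gram_const _ SQ) gramT.
Qed.

End Recursion.

(** * Orthogonality of the q_n and of their derivatives *)

Section GegenbauerQ.
Variables (R : realType) (a : R) (L : {scalar {poly R}}).
Variable p : nat -> {poly R}.
Hypothesis p_op : forall n, monic_op L n (p n).
Local Notation q := (gegenbauer_q a p).

(** One formula for all [n]; below 2 the index [n.-2] truncates to 0, and [c = 0] removes that
    term. *)
Lemma gegenbauer_qE n : exists2 c, q n = p n + c *: p n.-2 & (n < 2)%N -> c = 0.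
Proof.
case: n => [|[|n]] /=; [exists 0|exists 0|by eexists] => //;
  by rewrite scale0r addr0// (op0 p_op).
Qed.

Lemma gegenbauer_q_size n : (size (q n) <= n.+1)%N.
Proof.
have [c -> _] := gegenbauer_qE n; apply: leq_trans (size_polyD _ _) _.
rewrite geq_max (op_size p_op) leqnn (leq_trans (size_scale_leq _ _))//.
by rewrite (op_size p_op) ltnS -subn2 leq_subr.
Qed.

Lemma gegenbauer_q_coef n : (q n)`_n = 1.
Proof.
have [c -> c0] := gegenbauer_qE n; rewrite coefD (op_coef p_op) coefZ.
have [/c0 ->|n2] := ltnP n 2; first by rewrite mul0r addr0.
by rewrite (op_coef_gt p_op) ?mulr0 ?addr0//; lia.
Qed.

Lemma gegenbauer_q_ortho i j :
  [&& i != j, i != j.+2 & j != i.+2] -> L (q i * q j) = 0.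
Proof.
move=> /and3P[ij ij2 ji2].
have [c -> c0] := gegenbauer_qE i; have [d -> d0] := gegenbauer_qE j.
have Lp k l : k != l -> L (p k * p l) = 0 by exact: op_ortho.
rewrite mulrDl !mulrDr -!scalerAr -!scalerAl !linearD !linearZ_LR /=.
(* Index inequalities are asked for only when the coefficient is nonzero, that is, when no
   predecessor is truncated. *)
have Z k l (e : R) : (e != 0 -> k != l) -> e * L (p k * p l) = 0.
  by have [->|e0 kl] := eqVneq e 0; rewrite ?mul0r// Lp ?mulr0// kl.
have c2 : c != 0 -> (1 < i)%N by rewrite ltnNge; apply: contra => /c0/eqP.
have d2 : d != 0 -> (1 < j)%N by rewrite ltnNge; apply: contra => /d0/eqP.
rewrite mulrA Lp// !Z ?addr0//.
- by rewrite mulf_eq0 negb_or => /andP[/d2 dj /c2 ci]; lia.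
- by move=> /c2 ci; lia.
- by move=> /d2 dj; lia.
Qed.

Hypothesis a_gt : - 2^-1 < a.
Hypothesis L_pos : forall f : {poly R}, f != 0 -> 0 < L (f ^+ 2).
Hypothesis L_pearson : forall f, L (pearson a f) = 0.

Lemma deriv_gegenbauer_q_ortho i j : i != j -> L ((q i)^`() * (q j)^`()) = 0.
Proof.
case: i j => [|i] [|j] // ij; rewrite ?[(gegenbauer_q a p 0)^`()]derivC ?mul0r ?mulr0 ?linear0//.
rewrite !(deriv_gegenbauer_q a_gt L_pos L_pearson p_op) -scalerAl -scalerAr.
by rewrite !linearZ_LR /= (op_ortho p_op) ?mulr0.
Qed.

End GegenbauerQ.

(** * From integrals to abstract forms, and the theorem *)

Lemma gint_op (R : realType) (a : R) (a_gt : - 2^-1 < a) n (p : {poly R}) :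
  monic_orthogonal_poly a n p -> monic_op (gint_linear a_gt) n p.
Proof.
case=> sp pm po; split=> // g /po; rewrite /= /gint => <-.
by apply: eq_Rintegral => x _; rewrite hornerM.
Qed.

Lemma grad_innerE (R : realType) (a b : R) (a_gt : - 2^-1 < a) (b_gt : - 2^-1 < b) P Q :
  grad_inner a b P Q = grad_ip (gint_linear a_gt) (gint_linear b_gt) P Q.
Proof.
rewrite /grad_inner /grad_ip -!square_integral_poly.
congr (_^-1 * _); congr square_integral; apply/funext => z.
  by rewrite !hornerC mul1r.
by rewrite !hornerD !hornerM.
Qed.

Theorem theorem4p5 (R : realType) (alpha beta : R)
    (p r : nat -> {poly R})
    (S : forall n : nat, 'cV[{poly {poly R}}]_(n.+1))
    (halpha : - 2^-1 < alpha) (hbeta : - 2^-1 < beta)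
    (hp : forall n : nat, monic_orthogonal_poly alpha n (p n))
    (hr : forall n : nat, monic_orthogonal_poly beta n (r n))
    (hS : forall n : nat, (1 <= n)%N -> forall k : 'I_n.+1,
        monic_grad_orthogonal alpha beta n k (S n k 0)) :
  let Q := product_q alpha beta p r in
  let C := fun n : nat => grad_gram alpha beta (Q n.+2) (Q n) in
  let D := fun n : nat => grad_gram alpha beta (Q n) (Q n) in
  let H := fun n : nat => grad_gram alpha beta (S n) (S n) in
  [/\ H 1%N = 1%:M,
      H 2%N = D 2%N,
      (forall n : nat, (1 <= n)%N -> H n \in unitmx),
      (forall n : nat, (1 <= n)%N ->
         H n.+2 = D n.+2 - C n *m invmx (H n) *m (C n)^T) &
      (forall n : nat, (1 <= n)%N -> forall B : 'M[R]_(n.+3, n.+1),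
         eq_upto_const (Q n.+2) (S n.+2 + real_mulmx B (S n)) <->
         B = C n *m invmx (H n))].
Proof.
move=> Q C D H.
pose La := gint_linear halpha; pose Lb := gint_linear hbeta.
have p_op n : monic_op La n (p n) by exact: gint_op.
have r_op n : monic_op Lb n (r n) by exact: gint_op.
have La_pos f : f != 0 -> 0 < La (f ^+ 2) by exact: gint_sqr_gt0.
have Lb_pos f : f != 0 -> 0 < Lb (f ^+ 2) by exact: gint_sqr_gt0.
have La_pearson f : La (pearson alpha f) = 0 by exact: gint_pearson.
have Lb_pearson f : Lb (pearson beta f) = 0 by exact: gint_pearson.
pose ip := grad_ip La Lb.
have gramE m n (F : 'cV_m) (G : 'cV_n) : grad_gram alpha beta F G = gram ip F G.
  by apply/matrixP => i j; rewrite !mxE grad_innerE.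
have QE n k : Q n k 0 = (gegenbauer_q alpha p (n - k))^:P * (gegenbauer_q beta r k)%:P.
  by rewrite mxE.
have ipQ f f' g g' : ip (f^:P * g%:P) (f'^:P * g'%:P) = (La 1 * Lb 1)^-1 *
    (La (f^`() * f'^`()) * Lb (g * g') + La (f * f') * Lb (g^`() * g'^`())).
  rewrite /ip /grad_ip !dx_poly2 !dy_poly2 ![_ * _%:P * _]mulrACA -!rmorphM.
  rewrite poly2_functionalD !poly2_functionalM; congr (_^-1 * _).
  by rewrite -poly2_functionalM rmorph1 mul1r.
have S_ortho n (k : 'I_n.+1) g : (0 < n)%N -> tdegree_le n.-1 g -> ip (S n k 0) g = 0.
  by move=> n0 /(hS n n0 k).2; rewrite grad_innerE.
(* From here on the integrals enter only through the properties of the two forms collected above. *)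
clearbody La Lb.
have Q_monic n (k : 'I_n.+1) : tdegree_le n.-1 (Q n k 0 - 'X^(n - k) * 'Y ^+ k).
  have kn : (k <= n)%N by rewrite -ltnS.
  apply: tdegree_leSB.
  - rewrite QE -[n in tdegree_le n](subnK kn).
    by apply: tdegree_le_poly2; exact: gegenbauer_q_size.
  - rewrite monomialE -[n in tdegree_le n](subnK kn).
    by apply: tdegree_le_poly2; rewrite size_polyXn.
  move=> i j ijn; rewrite QE coef_poly2 coef_monomial.
  have q0 c (t : nat -> {poly R}) L m l : (forall n, monic_op L n (t n)) -> (m < l)%N ->
      (gegenbauer_q c t m)`_l = 0.
    by move=> t_op ml; rewrite nth_default//; exact: leq_trans (gegenbauer_q_size _ t_op _) ml.
  have [jk|jk|jk] := ltngtP j k.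
  + by rewrite (q0 _ _ La) ?mul0r ?andbF//; lia.
  + by rewrite (q0 _ _ Lb _ _ r_op jk) mulr0 andbF.
  + have -> : i = (n - k)%N by lia.
    transitivity (1 * 1 : R); last by rewrite eqxx mulr1.
    congr (_ * _); first exact: (gegenbauer_q_coef alpha p_op).
    by rewrite jk; exact: (gegenbauer_q_coef beta r_op).
have Q_ortho n m (k : 'I_n.+1) (l : 'I_m.+1) :
    [&& n != m, n != m.+2 & m != n.+2] -> ip (Q n k 0) (Q m l 0) = 0.
  have kn : (k <= n)%N by rewrite -ltnS.
  have lm : (l <= m)%N by rewrite -ltnS.
  move=> /and3P[nm nm2 mn2]; rewrite !QE ipQ.
  (* Derivatives of different degrees are orthogonal. If the degrees in x agree, those in y differ
     by [n - m], which is none of 0, 2, -2, and the other factor vanishes. *)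
  have -> : La ((gegenbauer_q alpha p (n - k))^`() * (gegenbauer_q alpha p (m - l))^`()) *
      Lb (gegenbauer_q beta r k * gegenbauer_q beta r l) = 0.
    have [e|e] := eqVneq (n - k)%N (m - l)%N.
      by rewrite [Lb _](gegenbauer_q_ortho beta r_op) ?mulr0//; apply/and3P; split; lia.
    by rewrite (deriv_gegenbauer_q_ortho p_op halpha La_pos La_pearson e) mul0r.
  have -> : La (gegenbauer_q alpha p (n - k) * gegenbauer_q alpha p (m - l)) *
      Lb ((gegenbauer_q beta r k)^`() * (gegenbauer_q beta r l)^`()) = 0.
    have [e|e] := eqVneq (k : nat) (l : nat).
      by rewrite [La _](gegenbauer_q_ortho alpha p_op) ?mul0r//; apply/and3P; split; lia.
    by rewrite (deriv_gegenbauer_q_ortho r_op hbeta Lb_pos Lb_pearson e) mulr0.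
  by rewrite addr0 mulr0.
have ipC : forall P T, ip P T = ip T P by exact: grad_ipC.
have ipD : forall P P' T, ip (P + P') T = ip P T + ip P' T by exact: grad_ipD.
have ipZ : forall c P T, ip (c%:P%:P * P) T = c * ip P T by exact: grad_ipZ.
have ip_const : forall c T, ip c%:P%:P T = 0 by exact: grad_ip_const.
have ip_eq0 : forall P, ip P P = 0 -> exists c : R, P = c%:P%:P.
  exact: (grad_ip_eq0 La_pos Lb_pos p_op).
have S_monic n (k : 'I_n.+1) : (0 < n)%N ->
    tdegree_le n.-1 (S n k 0 - 'X^(n - k) * 'Y ^+ k).
  by move=> n0; case: (hS n n0 k).
have init n : (0 < n)%N -> (n <= 2)%N -> gram ip (S n) (S n) = gram ip (Q n) (Q n).
  by move=> n0 n2; apply: gram_S_initial.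
rewrite /H /C /D; split.
(* The entries of [Q 1] have the two unit vectors as gradients, because q_1' = 1; the normalisation
   cancels [La 1 * Lb 1]. *)
- rewrite gramE init//; apply/matrixP => i j; rewrite [LHS]mxE !QE !mxE.
  have da : (gegenbauer_q alpha p 1)^`() = 1.
    by rewrite (deriv_gegenbauer_q halpha La_pos La_pearson p_op) scale1r (op0 p_op).
  have db : (gegenbauer_q beta r 1)^`() = 1.
    by rewrite (deriv_gegenbauer_q hbeta Lb_pos Lb_pearson r_op) scale1r (op0 r_op).
  have da0 : (gegenbauer_q alpha p 0)^`() = 0 by exact: derivC.
  have db0 : (gegenbauer_q beta r 0)^`() = 0 by exact: derivC.
  have qa0 : gegenbauer_q alpha p 0 = 1 by [].
  have qb0 : gegenbauer_q beta r 0 = 1 by [].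
  have La0 : La 0 = 0 by exact: linear0.
  have Lb0 : Lb 0 = 0 by exact: linear0.
  have L1 : La 1 * Lb 1 != 0.
    by rewrite mulf_neq0// gt_eqF// -(expr1n _ 2); [apply: La_pos|apply: Lb_pos]; exact: oner_neq0.
  rewrite ipQ -(inj_eq (@ord_inj _)).
  move: (nat_of_ord i) (nat_of_ord j) (ltn_ord i) (ltn_ord j) => k l.
  case: k l => [|[|//]] [|[|//]] _ _; rewrite ?subn0 ?subnn.
  + by rewrite da db0 qb0 !mulr0 Lb0 mulr0 addr0 !mulr1 mulVf.
  + by rewrite da0 ?db0 !(mulr0, mul0r) La0 Lb0 !(mulr0, mul0r) addr0 mulr0.
  + by rewrite da0 ?db0 !(mulr0, mul0r) La0 Lb0 !(mulr0, mul0r) addr0 mulr0.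
  + by rewrite da0 db qa0 !mulr0 La0 mul0r add0r !mulr1 mulVf.
- by rewrite !gramE init.
- by move=> n n0; rewrite gramE; apply: gram_S_unit.
- by move=> n n0; rewrite !gramE; apply: gram_S_recursion.
- by move=> n n0 B; rewrite !gramE; apply: Q_relationP.
Qed.
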